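(* Let $(\mathcal{M},\tau)$ be a von Neumann algebra with a normal faithful tracial state, $\mathcal{N}\subset\mathcal{M}$ a von Neumann subalgebra, and let $\mathcal{N}\subset A_j\subset\mathcal{M}$, $j=1,\dots,n$, be von Neumann subalgebras that are successively independent over $\mathcal{N}$. Let $a_j\in A_j$ be self-adjoint and let $\sigma_j,M_j\ge 0$ be real numbers with $\sum_{j=1}^n\sigma_j^2>0$ and $\sup_{j}M_j>0$, such that for every $j$: (i) $E_{\mathcal{N}}(a_j)=0$; (ii) $E_{\mathcal{N}}(a_j^2)\le\sigma_j^2$; (iii) $\|a_j\|\le M_j$. Then for every $t\ge 0$, $$\operatorname{Prob}\Big(\sum_{j=1}^n a_j\ge t\Big)\le\exp\left(-\frac{t^2}{2\sum_{j=1}^n\sigma_j^2+(2t/3)\sup_{j=1,\dots,n}M_j}\right)$$ and $$\operatorname{Prob}\Big(\sum_{j=1}^n a_j\ge t\Big)\le\exp\left(-\frac{t}{2\sup_{j=1,\dots,n}M_j}\operatorname{arcsinh}\left(\frac{t\,\sup_{j=1,\dots,n}M_j}{2\sum_{j=1}^n\sigma_j^2}\right)\right).$$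
   Context: $\tau$ is a state with $\tau(1)=1$ and $\tau(xy)=\tau(yx)$. $E_{\mathcal{N}}:\mathcal{M}\to\mathcal{N}$ denotes the unique $\tau$-preserving conditional expectation: $E_{\mathcal{N}}(1)=1$ and $E_{\mathcal{N}}(axb)=aE_{\mathcal{N}}(x)b$ for $a,b\in\mathcal{N}$, $x\in\mathcal{M}$. Two subalgebras $\mathcal{N}\subset A,B\subset\mathcal{M}$ are independent over $\mathcal{N}$ if $E_{\mathcal{N}}(ab)=E_{\mathcal{N}}(a)E_{\mathcal{N}}(b)$ for all $a\in A$, $b\in B$. The subalgebras $A_1,\dots,A_n$ are successively independent over $\mathcal{N}$ if, for each $1\le k<n$, $A_{k+1}$ is independent over $\mathcal{N}$ of the algebra generated by $A_1,\dots,A_k$. $\|\cdot\|$ is the operator norm. For self-adjoint $a$, $\operatorname{Prob}(a\ge t):=\tau(1_{[t,\infty)}(a))$, where $1_{[t,\infty)}(a)$ is the spectral projection of $a$ corresponding to $[t,\infty)$. *)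

(* Defs.v *)
From HB Require Import structures.
From mathcomp Require Import all_boot all_order all_algebra.
From mathcomp Require Import complex.
From mathcomp Require Import all_classical all_reals all_analysis.

Set Implicit Arguments.
Unset Strict Implicit.
Unset Printing Implicit Defensive.

Import Order.TTheory GRing.Theory Num.Theory.
Import numFieldNormedType.Exports.

Local Open Scope classical_set_scope.
Local Open Scope ring_scope.
Local Open Scope complex_scope.

(* Operators on H are plain functions H -> H: sums, scalar multiples and 0 are
   those of the function space, the product is the composition \o, and the unit
   is idfun. *)
Section Operators.
Variables (R : realType) (H : completeNormedModType R[i]).
Variable ip : {dot H for Num.conj}.

(* The norm of H is R[i]-valued, as for every normedModType over R[i]. *)
Definition hilbert : Prop := forall x : H, ip x x = `|x| ^+ 2.

Definition bounded_op : set (H -> H) := [set a | linear a /\ continuous a].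

Definition opnorm (a : H -> H) : R :=
  sup [set complex.Re `|a x| | x in [set x : H | `|x| <= 1]].

Definition adjoint (a b : H -> H) : Prop := forall x y, ip (a x) y = ip x (b y).

Definition selfadjoint (a : H -> H) : Prop := adjoint a a.

(* The order of R[i] makes 0 <= z say that z is real and nonnegative. *)
Definition positive_op (a : H -> H) : Prop := forall x, 0 <= ip (a x) x.

Definition ople (a b : H -> H) : Prop := positive_op (b - a).

Definition commutant (S : set (H -> H)) : set (H -> H) :=
  [set b | bounded_op b /\ forall a, S a -> a \o b = b \o a].

Record von_neumann_algebra (M : set (H -> H)) : Prop := VonNeumannAlgebra {
  vna_bounded : M `<=` bounded_op ;
  vna_adjoint : forall a, M a -> exists2 b, M b & adjoint a b ;
  vna_bicommutant : commutant (commutant M) = M }.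

Definition linear_on (M : set (H -> H)) (V : lmodType R[i])
    (f : (H -> H) -> V) : Prop :=
  forall (z : R[i]) a b, M a -> M b -> f (z *: a + b) = z *: f a + f b.

Definition is_supremum (M D : set (H -> H)) (s : H -> H) : Prop :=
  [/\ M s, selfadjoint s, forall d, D d -> ople d s &
    forall b, M b -> selfadjoint b -> (forall d, D d -> ople d b) -> ople s b].

Definition upward_directed (D : set (H -> H)) : Prop :=
  D !=set0 /\
  forall a b, D a -> D b -> exists c, [/\ D c, ople a c & ople b c].

(* Only the values of tau on M matter. *)
Record normal_faithful_tracial_state (M : set (H -> H))
    (tau : (H -> H) -> R[i]) : Prop := NormalFaithfulTracialState {
  nfts_linear : linear_on M (tau : _ -> R[i]^o) ;
  nfts_positive : forall a, M a -> positive_op a -> 0 <= tau a ;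
  nfts_unit : tau idfun = 1 ;
  nfts_tracial : forall a b, M a -> M b -> tau (a \o b) = tau (b \o a) ;
  nfts_faithful : forall a b, M a -> M b -> adjoint a b ->
    tau (b \o a) = 0 -> a = 0 ;
  nfts_normal : forall D s, D `<=` M `&` selfadjoint -> upward_directed D ->
    is_supremum M D s -> isLub (tau @` D) (tau s) }.

Record conditional_expectation (M N : set (H -> H)) (tau : (H -> H) -> R[i])
    (E : (H -> H) -> (H -> H)) : Prop := ConditionalExpectation {
  ce_range : forall x, M x -> N (E x) ;
  ce_linear : linear_on M E ;
  ce_positive : forall x, M x -> positive_op x -> positive_op (E x) ;
  ce_unit : E idfun = idfun ;
  ce_bimodule : forall a b x, N a -> N b -> M x ->
    E (a \o x \o b) = a \o E x \o b ;
  ce_trace : forall x, M x -> tau (E x) = tau x }.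

Definition subalgebra (A : set (H -> H)) : Prop :=
  [/\ A idfun,
      forall (z : R[i]) a b, A a -> A b -> A (z *: a + b) &
      forall a b, A a -> A b -> A (a \o b)].

Definition generated_algebra (S : set (H -> H)) : set (H -> H) :=
  smallest subalgebra S.

Definition independent (E : (H -> H) -> (H -> H)) (A B : set (H -> H)) : Prop :=
  forall a b, A a -> B b -> E (a \o b) = E a \o E b.

(* With indices starting from 0, [A k] is the algebra A_{k+1}, and the [A i]
   with i < k are A_1, ..., A_k. *)
Definition successively_independent (E : (H -> H) -> (H -> H)) (n : nat)
    (A : 'I_n -> set (H -> H)) : Prop :=
  forall k : 'I_n, (0 < k)%N ->
    independent E (A k)
      (generated_algebra (\bigcup_(i in [set i : 'I_n | (i < k)%N]) A i)).

Definition projection (p : H -> H) : Prop :=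
  [/\ bounded_op p, selfadjoint p & p \o p = p].

(* P is the spectral measure of the self-adjoint element a of M: a measure on
   the Borel sets of R with values in the projections of M, countably additive
   in the weak sense, with a = \int y dP(y) in the weak sense. *)
Record spectral_measure (M : set (H -> H)) (a : H -> H)
    (P : set R -> H -> H) : Prop := SpectralMeasure {
  sm_proj : forall B, measurable B -> M (P B) /\ projection (P B) ;
  sm_setT : P setT = idfun ;
  sm_setI : forall B C, measurable B -> measurable C ->
    P (B `&` C) = P B \o P C ;
  sm_integral : forall x : H,
    exists mu : {finite_measure set R -> \bar R},
      [/\ forall B, measurable B -> ip (P B x) x = (fine (mu B))%:C,
          mu.-integrable setT (EFin : R -> \bar R) &
          ip (a x) x = (\int[mu]_(y in setT) y)%R%:C] }.

(* Prob(a >= t), for P the spectral measure of a; the trace of a projection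
   is real. *)
Definition Prob (tau : (H -> H) -> R[i]) (P : set R -> H -> H) (t : R) : R :=
  complex.Re (tau (P [set x | t <= x])).

End Operators.

Definition arcsinh (R : realType) (x : R) : R := ln (x + Num.sqrt (x ^+ 2 + 1)).

(* Main.v *)
Require Import Defs.
From HB Require Import structures.
From mathcomp Require Import all_boot all_order all_algebra.
From mathcomp Require Import complex.
From mathcomp Require Import all_classical all_reals all_analysis.
From mathcomp Require Import ring lra.
Import Order.TTheory GRing.Theory Num.Theory.
Import numFieldNormedType.Exports.
Local Open Scope classical_set_scope.
Local Open Scope ring_scope.
Local Open Scope complex_scope.

Set Implicit Arguments.
Unset Strict Implicit.
Unset Printing Implicit Defensive.

(** The classical argument of Bennett bounds the moment generating function
    of the sum and applies the inequality of Markov.  In a tracial algebra the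
    exponential of a sum does not factor, but the Golden-Thompson inequality
    [tr (exp (x + y)) <= tr (exp x * exp y)] is enough: with [x] the sum of the
    first variables and [y] the next one, independence over N and the bound
    [E (exp (l a)) <= 1 + r sigma^2 <= exp (r sigma^2)], where
    [r = (exp (l B) - 1 - l B) / B^2] and B bounds the norms, peel off one
    factor at a time.  This gives
    [Prob (sum >= t) <= exp (r * sum_j sigma_j^2 - l t)] for every [l >= 0],
    and the two bounds of the theorem are two choices of [l].

    Independence is assumed for the generated algebra only, without closure,
    and no functional calculus is set up.  For both reasons the exponential
    [exp (l x)] is replaced throughout by the power [(1 + (l / m) x)^m], a
    polynomial in x, with [m = 2^j]; only real numbers are passed to the limit.
    The power of two serves the Golden-Thompson inequality: the finite version
    [tr ((x y)^m) <= tr (x^m y^m)] for self-adjoint x and y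
    ([tr_golden_thompson]) follows from the Cauchy-Schwarz inequality by
    induction on the exponent of two, and
    [(1 + x / m) (1 + y / m) = 1 + (x + y) / m + x y / m^2] differs from
    [1 + (x + y) / m] so little that exchanging their m-th powers changes the
    trace by O(1 / m) ([vtr_powD_golden_thompson]).

    The bound on the conditional expectation comes from the operator inequality
    [(1 + e a)^m <= 1 + m e a + c a^2] ([pos_quadratic_powD]), whose remainder
    has the form [a q a] with q bounded.  On the side of Markov's inequality,
    the spectral measure enters only through the compression by
    [p = P [t, oo[], which satisfies [p a p >= t p] ([spectral_tail]); repeated
    squaring carries this over to the powers ([vtr_markov]). *)

(** * The Golden-Thompson inequality for powers of two *)

Section TracialAlgebra.
Variables (R : realType) (T : algType R).
Variables (star : {linear T -> T}) (tr : {scalar T}).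
Hypothesis starK : involutive star.
Hypothesis starM : forall x y, star (x * y) = star y * star x.
Hypothesis trC : forall x y, tr (x * y) = tr (y * x).
Hypothesis tr_star : forall x, tr (star x) = tr x.
Hypothesis tr_gram_ge0 : forall x, 0 <= tr (star x * x).

Lemma star1 : star 1 = 1.
Proof. by rewrite -[LHS]mul1r -{1}[1]starK -starM mul1r starK. Qed.

Lemma starX x n : star (x ^+ n) = star x ^+ n.
Proof.
elim: n => [|n IH]; first by rewrite !expr0 star1.
by rewrite exprS starM IH exprSr.
Qed.

(** A nonnegative quadratic polynomial has a nonpositive discriminant; here the
    polynomial in s is [tr (star z * z)] at [z = star x - s y]. *)
Lemma tr_cauchy_schwarz x y :
  tr (x * y) ^+ 2 <= tr (star x * x) * tr (star y * y).
Proof.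
have q s : 0 <= tr (star x * x) - 2 * s * tr (x * y)
                + s ^+ 2 * tr (star y * y).
  have -> : tr (star x * x) - 2 * s * tr (x * y) + s ^+ 2 * tr (star y * y) =
            tr (star (star x - s *: y) * (star x - s *: y)).
    have -> : star (star x - s *: y) * (star x - s *: y) =
        x * star x - s *: (x * y) - s *: (star y * star x)
        + s *: (s *: (star y * y)).
      rewrite linearB linearZ/= starK mulrBl !mulrBr.
      by rewrite -!scalerAl -!scalerAr opprB addrA addrAC.
    rewrite linearD !linearB/= !scalarZ -starM tr_star (trC x (star x)).
    by ring.
  exact: tr_gram_ge0.
have cge := tr_gram_ge0 y; have age := tr_gram_ge0 x.
move: (tr (x * y)) (tr (star x * x)) (tr (star y * y)) cge age q.
move=> b a c c0 a0 q.
have [cE|cN] := eqVneq c 0.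
  have [->|bN] := eqVneq b 0; first by rewrite expr0n mulr_ge0.
  (* The polynomial is affine: this s would make it equal to -1. *)
  have := q ((a + 1) / (2 * b)); have -> : 2 * ((a + 1) / (2 * b)) * b = a + 1.
    by field.
  by rewrite cE mulr0 addr0; lra.
have cp : 0 < c by rewrite lt_neqAle eq_sym cN.
have := q (b / c); have -> : a - 2 * (b / c) * b + (b / c) ^+ 2 * c =
    (a * c - b ^+ 2) / c by field.
by rewrite pmulr_lge0 ?invr_gt0 // subr_ge0.
Qed.

Lemma tr_cycleX x y n : tr ((x * y) ^+ n) = tr ((y * x) ^+ n).
Proof.
case: n => [//|n].
suff -> : (x * y) ^+ n.+1 = x * (y * x) ^+ n * y.
  by rewrite trC mulrA -exprS.
elim: n => [|n IH]; first by rewrite expr1 expr0 mulr1.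
by rewrite exprS IH (exprS (y * x)) !mulrA.
Qed.

Lemma sqr_expn2 (x : T) k : (x * x) ^+ (2 ^ k) = x ^+ (2 ^ k.+1).
Proof. by rewrite -expr2 -exprM expnS. Qed.

Lemma tr_gramX_ge0 x k : 0 <= tr ((star x * x) ^+ (2 ^ k)).
Proof.
case: k => [|k]; first by rewrite expn0 expr1.
have sa : star (star x * x) = star x * x by rewrite starM starK.
rewrite expnS mulnC exprM expr2.
by rewrite -{1}sa -starX.
Qed.

(** Hoelder's inequality for the Schatten norm of order [2^(k+1)], applied to
    the alternating word in x and y.  The induction uses itself twice: once
    for the word [x y] repeated, which turns [tr ((x y)^(2^(k+1)))] into the
    trace of a power of [star y * star x * x * y], and once for the two
    positive factors [star x * x] and [y * star y] into which this product
    splits after a cyclic permutation. *)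
Lemma tr_expn2_holder x y k : tr ((x * y) ^+ (2 ^ k)) ^+ 2 <=
  tr ((star x * x) ^+ (2 ^ k)) * tr ((star y * y) ^+ (2 ^ k)).
Proof.
elim: k x y => [|k IH] x y; first by rewrite !expr1 tr_cauchy_schwarz.
rewrite -!sqr_expn2 (le_trans (IH _ _)) // -expr2.
have -> : tr ((star (x * y) * (x * y)) ^+ (2 ^ k)) =
          tr (((star x * x) * (y * star y)) ^+ (2 ^ k)).
  by rewrite starM -mulrA tr_cycleX !mulrA.
rewrite (le_trans (IH _ _)) // !starM !starK.
by rewrite [X in _ * X](_ : _ = tr ((star y * y * (star y * y)) ^+ (2 ^ k)))
  // !sqr_expn2 tr_cycleX.
Qed.

(** With both letters equal to [x y], [tr_expn2_holder] replaces
    [(x y)^(2^(k+1))] by [(x^2 y^2)^(2^k)], and the induction hypothesis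
    applies to the squares. *)
Theorem tr_golden_thompson x y k : star x = x -> star y = y ->
  tr ((x * y) ^+ (2 ^ k)) <= tr (x ^+ (2 ^ k) * y ^+ (2 ^ k)).
Proof.
elim: k x y => [|k IH] x y sx sy; first by rewrite !expr1.
rewrite -!sqr_expn2; apply: le_trans (IH (x * x) (y * y) _ _); last 2 first.
- by rewrite starM sx.
- by rewrite starM sy.
have -> : tr ((x * x * (y * y)) ^+ (2 ^ k)) =
          tr ((star (x * y) * (x * y)) ^+ (2 ^ k)).
  by rewrite starM sx sy -(mulrA y x) (tr_cycleX y) !mulrA.
have := tr_expn2_holder (x * y) (x * y) k; rewrite -expr2.
have := tr_gramX_ge0 (x * y) k; nra.
Qed.

End TracialAlgebra.

(** * Real inequalities *)

Section Scalar.
Variable R : realType.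
Implicit Types x y t : R.

Lemma is_derive_ge0_le (f df : R -> R) x : 0 <= x ->
  (forall y, is_derive y 1 f (df y)) -> (forall y, 0 <= y -> 0 <= df y) ->
  f 0 <= f x.
Proof.
move=> x0 fD df0.
have cf : {within `[0, x], continuous f}.
  apply: derivable_within_continuous => y _.
  exact: (@ex_derive _ _ _ _ _ _ _ (fD y)).
have [c + fE] := @MVT_segment R f df 0 x x0 (fun y _ => fD y) cf.
rewrite in_itv /= => /andP[c0 _].
by rewrite -subr_ge0 fE subr0 mulr_ge0 ?df0.
Qed.

Lemma expR_ge_deg2 x : 0 <= x -> 1 + x + x ^+ 2 / 2 <= expR x.
Proof.
move=> x0.
have := @is_derive_ge0_le (fun y => expR y - (y + y ^+ 2 / 2))
  (fun y => expR y - (1 + y)) x x0.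
rewrite expR0 expr0n /= mul0r addr0 subr0 => H.
suff: 1 <= expR x - (x + x ^+ 2 / 2) by lra.
apply: H => [y|y y0]; last by rewrite subr_ge0 expR_ge1Dx.
apply: is_derive_eq; rewrite /GRing.scale /=; by field.
Qed.

(** A Pade approximant of the exponential. *)
Lemma expR_pade x : 0 <= x -> expR x * (6 - 2 * x) <= 6 + 4 * x + x ^+ 2.
Proof.
move=> x0.
have := @is_derive_ge0_le
  (fun y => expR (- y) * (6 + 4 * y + y ^+ 2) + 2 * y)
  (fun y => 2 - expR (- y) * (2 + 2 * y + y ^+ 2)) x x0.
rewrite oppr0 expR0 expr0n /= !mulr0 !addr0 mul1r => H.
have : 6 <= expR (- x) * (6 + 4 * x + x ^+ 2) + 2 * x.
  apply: H => [y|y y0].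
    by apply: is_derive_eq; rewrite /GRing.scale /=; ring.
  have := expR_ge_deg2 y0; rewrite expRN => yE.
  rewrite subr_ge0 mulrC ler_pdivrMr ?expR_gt0 //; lra.
rewrite expRN => h; rewrite mulrC -ler_pdivlMr ?expR_gt0 // mulrC; lra.
Qed.

(** This is [tanh (x / 2) <= x / 2]. *)
Lemma expR_sub1_le_mulD1 x : 0 <= x -> 2 * (expR x - 1) <= x * (expR x + 1).
Proof.
move=> x0.
have := @is_derive_ge0_le
  (fun y => y * (expR y + 1) - 2 * (expR y - 1))
  (fun y => 1 - (1 - y) * expR y) x x0.
rewrite expR0 subrr mul0r mulr0 subr0 => H.
suff: 0 <= x * (expR x + 1) - 2 * (expR x - 1) by lra.
apply: H => [y|y y0].
  by apply: is_derive_eq; rewrite /GRing.scale /=; ring.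
have := expR_ge1Dx (- y); rewrite expRN => h.
by rewrite subr_ge0 -ler_pdivlMr ?expR_gt0 // mul1r; lra.
Qed.

Lemma expR_sub1_bernstein x : 0 <= x -> x < 3 ->
  expR x - 1 - x <= x ^+ 2 / (2 * (1 - x / 3)).
Proof.
move=> x0 x3; have := expR_pade x0 => h.
rewrite ler_pdivlMr; last lra.
nra.
Qed.

(** By [tanh (x / 2) <= x / 2] the right-hand side, [x sinh x], is at least
    [2 (cosh x - 1) = (exp x - 1) + (exp (- x) - 1)], and the second summand is
    at least [- x]. *)
Lemma expR_sub1_sinh x : 0 <= x ->
  expR x - 1 - x <= x * ((expR x - expR (- x)) / 2).
Proof.
move=> x0; have h := expR_sub1_le_mulD1 x0; have w1 := expR_ge1Dx (- x).
have := expRxMexpNx_1 x; have r1 := expR_ge1Dx x; have w0 := expR_gt0 (- x).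
move: (expR x) (expR (- x)) h w1 r1 w0 => r w h w1 r1 w0 rw.
have : 0 <= (x * (r + 1) - 2 * (r - 1)) * ((r - 1) * w).
  apply: mulr_ge0; first by lra.
  by apply: mulr_ge0; lra.
have -> : (x * (r + 1) - 2 * (r - 1)) * ((r - 1) * w) =
  x * (r * (r * w) - w) - 2 * (r * (r * w) - 2 * (r * w) + w) by ring.
rewrite rw; lra.
Qed.

Lemma arcsinhK x : 0 <= x ->
  0 <= arcsinh x /\ expR (arcsinh x) - expR (- arcsinh x) = 2 * x.
Proof.
move=> x0; rewrite /arcsinh; set s := Num.sqrt _.
have s2 : s ^+ 2 = x ^+ 2 + 1 by rewrite sqr_sqrtr // addr_ge0 ?sqr_ge0.
have s1 : 1 <= s.
  have := sqrtr_ge0 (x ^+ 2 + 1); rewrite -/s; have := sqr_ge0 x; nra.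
split; first by apply: ln_ge0; lra.
rewrite expRN lnK ?posrE; last by lra.
have xs0 : x + s != 0 by rewrite gt_eqF //; lra.
have -> : (x + s)^-1 = s - x.
  apply: (mulfI xs0); rewrite divff //; nra.
by ring.
Qed.

(** The common value at [u = m] of the bound [(exp (l u) - 1 - l u) / u^2],
    which increases with u: it controls [exp (l u)] by
    [1 + l u + bennett_rate m l * u^2] for [u <= m] and [l >= 0]. *)
Definition bennett_rate (m l : R) : R := (expR (l * m) - 1 - l * m) / m ^+ 2.

Definition bennett_exponent (V m t l : R) : R := V * bennett_rate m l - l * t.

(** Bound [exp x - 1 - x] by [x^2 / (2 (1 - x / 3))] at [x = l m].  For
    [l = t / (V + t m / 3)] the first term of the exponent becomes exactly half
    the second. *)
Lemma bernstein_exponent (V m t : R) : 0 < V -> 0 < m -> 0 <= t ->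
  exists2 l, 0 <= l &
    bennett_exponent V m t l <= - (t ^+ 2 / (2 * V + (2 * t / 3) * m)).
Proof.
move=> V0 m0 t0.
have tm0 : 0 <= t * m by rewrite mulr_ge0 // ltW.
have D0 : 0 < V + t * m / 3 by lra.
pose l := t / (V + t * m / 3).
have l0 : 0 <= l by rewrite divr_ge0 // ltW.
exists l => //; rewrite /bennett_exponent /bennett_rate.
have lm0 : 0 <= l * m by rewrite mulr_ge0 // ltW.
have lm3 : l * m < 3.
  by rewrite /l mulrAC ltr_pdivrMr //; lra.
have lE : 1 - l * m / 3 = V / (V + t * m / 3) by rewrite /l; field; lra.
have := expR_sub1_bernstein lm0 lm3; rewrite lE.
move: (expR _ - 1 - _) => u uE.
have : V * (u / m ^+ 2) <=
       V * ((l * m) ^+ 2 / (2 * (V / (V + t * m / 3))) / m ^+ 2).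
  by rewrite ler_pM2l // ler_pM2r // invr_gt0 exprn_gt0.
move=> /le_trans h; rewrite lerBlDr; apply: h.
rewrite le_eqVlt; apply/orP; left; apply/eqP; rewrite /l.
by field; rewrite !gt_eqF //; lra.
Qed.

(** With [s = l m] chosen such that [t m / V = 2 sinh s], the bound
    [exp s - 1 - s <= s sinh s] makes the first term of the exponent at most
    half the second. *)
Lemma prokhorov_exponent (V m t : R) : 0 < V -> 0 < m -> 0 <= t ->
  exists2 l, 0 <= l &
    bennett_exponent V m t l <= - (t / (2 * m) * arcsinh (t * m / (2 * V))).
Proof.
move=> V0 m0 t0.
have x0 : 0 <= t * m / (2 * V) by rewrite divr_ge0 ?mulr_ge0 // ltW.
have [s0] := arcsinhK x0; set s := arcsinh _ => sE.
exists (s / m); first by rewrite divr_ge0 // ltW.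
rewrite /bennett_exponent /bennett_rate divfK ?gt_eqF //.
have := expR_sub1_sinh s0; rewrite sE => h.
have : V * ((expR s - 1 - s) / m ^+ 2) <=
       V * (s * (2 * (t * m / (2 * V)) / 2) / m ^+ 2).
  by rewrite ler_pM2l // ler_pM2r // invr_gt0 exprn_gt0.
move=> /le_trans {}h; rewrite lerBlDr; apply: h.
rewrite le_eqVlt; apply/orP; left; apply/eqP.
by field; rewrite !gt_eqF.
Qed.

Lemma bernoulli_ineq y n : -1 <= y -> 1 + n%:R * y <= (1 + y) ^+ n.
Proof.
move=> y1; elim: n => [|n IH]; first by rewrite mul0r addr0 expr0.
have : (1 + n%:R * y) * (1 + y) <= (1 + y) ^+ n * (1 + y).
  by rewrite ler_wpM2r //; lra.
rewrite exprSr; apply: le_trans; rewrite -natr1.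
have : 0 <= n%:R * y ^+ 2 by rewrite mulr_ge0 ?ler0n ?sqr_ge0.
nra.
Qed.

Lemma expR_ge_powD x n : - n.+1%:R <= x -> (1 + x / n.+1%:R) ^+ n.+1 <= expR x.
Proof.
move=> xn; rewrite -[X in expR X](divfK (_ : n.+1%:R != 0)) ?pnatr_eq0 //.
rewrite expRM_natr lerXn2r ?nnegrE ?expR_ge0 ?expR_ge1Dx //.
by rewrite -lerBlDl sub0r ler_pdivlMr ?ltr0n // mulN1r.
Qed.

(** From [1 + y >= exp y * (1 - y^2)] at [y = x / n.+1] and the inequality of
    Bernoulli. *)
Lemma expR_le_powD x n : 0 <= x ->
  expR x * (1 - x ^+ 2 / n.+1%:R) <= (1 + x / n.+1%:R) ^+ n.+1.
Proof.
move=> x0; set m : R := n.+1%:R.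
have m0 : 0 < m by rewrite ltr0n.
set y := x / m; have y0 : 0 <= y by rewrite divr_ge0 // ltW.
have -> : x ^+ 2 / m = m * y ^+ 2 by rewrite /y; field; lra.
have [y1|y1] := lerP (y ^+ 2) 1; last first.
  apply: (@le_trans _ _ 0); last by rewrite exprn_ge0 // addr_ge0.
  rewrite pmulr_rle0 ?expR_gt0 // subr_le0.
  have : 1 <= m by rewrite ler1n.
  nra.
apply: (@le_trans _ _ (expR x * (1 + - y ^+ 2) ^+ n.+1)).
  by rewrite ler_pM2l ?expR_gt0 // -mulrN bernoulli_ineq //; lra.
have -> : expR x = expR y ^+ n.+1 by rewrite -expRM_natr divfK ?gt_eqF.
rewrite -exprMn lerXn2r ?nnegrE ?addr_ge0 //.
  by rewrite mulr_ge0 ?expR_ge0 //; lra.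
have := expR_ge1Dx (- y); have := expRxMexpNx_1 y; have := expR_gt0 y.
move: (expR y) (expR (- y)) => r w r0 rw w1.
have h : r * (1 - y) <= 1 by rewrite -[leRHS]rw ler_wpM2l // ltW.
have -> : r * (1 - y ^+ 2) = (1 + y) * (r * (1 - y)) by ring.
by rewrite -[leRHS]mulr1 ler_wpM2l // addr_ge0.
Qed.

Lemma le_of_le_div_expn2 (a b c : R) :
  (forall k, a <= b + c / (2 ^ k.+1)%:R) -> a <= b.
Proof.
move=> h; rewrite leNgt; apply/negP => ba.
have d0 : 0 < a - b by rewrite subr_gt0.
have := h (Num.truncn (c / (a - b))).
apply/negP; rewrite -ltNge -ltrBrDl ltr_pdivrMr ?ltr0n ?expn_gt0 //.
rewrite mulrC -ltr_pdivrMr //; apply: lt_le_trans (truncnS_gt _) _.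
by rewrite ler_nat (leq_trans _ (ltnW (ltn_expl _ (ltnSn 1)))).
Qed.

End Scalar.

(** * A tracial von Neumann algebra as a real algebra *)

Section VonNeumannAlgebra.
Variables (R : realType) (H : completeNormedModType R[i]).
Variables (ip : {dot H for Num.conj}).

Lemma ip_conj x y : ip x y = conjc (ip y x).
Proof. by rewrite hermC expr0 mul1r. Qed.

Lemma ipDl x y z : ip (x + y) z = ip x z + ip y z.
Proof. exact: linearDl. Qed.

Lemma ipBl x y z : ip (x - y) z = ip x z - ip y z.
Proof. exact: linearBl. Qed.

Lemma ipZl (a : R[i]) x y : ip (a *: x) y = a * ip x y.
Proof. exact: linearZl_LR. Qed.

Lemma ipDr x y z : ip z (x + y) = ip z x + ip z y.
Proof. exact: linearDr. Qed.

Lemma ipBr x y z : ip z (x - y) = ip z x - ip z y.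
Proof. exact: linearBr. Qed.

Lemma ipZr (a : R[i]) x y : ip x (a *: y) = conjc a * ip x y.
Proof. exact: linearZr_LR. Qed.

Lemma ip_inj x y : (forall z, ip z x = ip z y) -> x = y.
Proof.
move=> e; apply/eqP; rewrite -subr_eq0 -(dnorm_eq0 ip).
have ->: ip (x - y) (x - y) = 0 by rewrite ipBr e subrr.
by [].
Qed.

Lemma subalgebra_commutant (S : set (H -> H)) :
  S `<=` @bounded_op R H -> subalgebra (commutant S).
Proof.
move=> SB; split.
- split; first by split=> // x; exact: cvg_id.
  by [].
- move=> z a b [[la ca] ha] [[lb cb] hb]; split.
    split; last first.
      move=> x; apply: cvgD; last exact: cb.
      by apply: cvgZl_tmp; exact: ca.
    move=> w x y; rewrite !fctE la lb !scalerDr !scalerA (mulrC z w).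
    by rewrite addrACA.
  move=> s Ss; apply/funext => x /=.
  have [ls _] := SB _ Ss; rewrite !fctE ls.
  have /= -> := congr1 (fun f => f x) (ha _ Ss).
  by have /= -> := congr1 (fun f => f x) (hb _ Ss).
- move=> a b [[la ca] ha] [[lb cb] hb]; split.
    split; first by move=> w x y /=; rewrite lb la.
    by move=> x; apply: continuous_comp; [exact: cb|exact: ca].
  move=> s Ss; rewrite compA ha // -compA hb // compA.
Qed.

Variables (M : set (H -> H)) (tau : (H -> H) -> R[i]).

Lemma vna_subalgebra : von_neumann_algebra ip M -> subalgebra M.
Proof.
move=> hM; rewrite -(vna_bicommutant hM).
by apply: subalgebra_commutant => a [].
Qed.

(** The elements of M.  The hypotheses on M and tau are parameters of the type
    because the algebra structure depends on them: closure under the operations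
    on [hM], and [1 != 0] on [hT]. *)
Record vop (hM : von_neumann_algebra ip M)
  (hT : normal_faithful_tracial_state ip M tau) :=
  Vop { vfun :> H -> H ; vfunP : M vfun }.

Hypothesis hM : von_neumann_algebra ip M.
Hypothesis hT : normal_faithful_tracial_state ip M tau.

Local Notation T := (vop hM hT).

Lemma vop_inj (f g : T) : (forall x, f x = g x) -> f = g.
Proof.
case: f g => [f fM] [g gM] /= fg.
have fgE : f = g by apply/funext.
by rewrite fgE in fM *; congr Vop; exact: Prop_irrelevance.
Qed.

Lemma vop_ext (f g : T) : vfun f = vfun g -> f = g.
Proof. by move=> fg; apply: vop_inj => x; rewrite fg. Qed.

HB.instance Definition _ := gen_eqMixin T.
HB.instance Definition _ := gen_choiceMixin T.

Let M1 : M idfun. Proof. by case: (vna_subalgebra hM). Qed.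
Let MP (z : R[i]) (f g : T) : M (z *: vfun f + vfun g).
Proof. by case: (vna_subalgebra hM) => _ + _; apply; exact: vfunP. Qed.
Let MM (f g : T) : M (vfun f \o vfun g).
Proof. by case: (vna_subalgebra hM) => _ _; apply; exact: vfunP. Qed.
Let M0 : M 0.
Proof.
case: (vna_subalgebra hM) => i1 + _ => /(_ (-1) _ _ i1 i1).
by rewrite scaleN1r addNr.
Qed.
Let MZ (z : R[i]) (f : T) : M (z *: vfun f).
Proof. by have := MP z f (@Vop hM hT _ M0); rewrite /= addr0. Qed.
Let MD (f g : T) : M (vfun f + vfun g).
Proof. by have := MP 1 f g; rewrite scale1r. Qed.
Let MN (f : T) : M (- vfun f).
Proof. by have := MZ (-1) f; rewrite scaleN1r. Qed.

Definition vop_zero : T := Vop hM hT M0.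
Definition vop_one : T := Vop hM hT M1.
Definition vop_add (f g : T) : T := Vop hM hT (MD f g).
Definition vop_opp (f : T) : T := Vop hM hT (MN f).
Definition vop_mul (f g : T) : T := Vop hM hT (MM f g).
Definition vop_cscale (z : R[i]) (f : T) : T := Vop hM hT (MZ z f).
Definition vop_scale (r : R) (f : T) : T := vop_cscale r%:C f.

Lemma vop_linear (f : T) : linear f.
Proof. by have [] := vna_bounded hM (vfunP f). Qed.

HB.instance Definition _ (f : T) :=
  GRing.isLinear.Build R[i] H H *:%R (vfun f) (vop_linear f).

Program Definition vop_zmod := @GRing.isZmodule.Build T
  vop_zero vop_opp vop_add _ _ _ _.
Next Obligation. by move=> f g h; apply: vop_inj => x /=; exact: addrA. Qed.
Next Obligation. by move=> f g; apply: vop_inj => x /=; exact: addrC. Qed.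
Next Obligation. by move=> f; apply: vop_inj => x /=; exact: add0r. Qed.
Next Obligation. by move=> f; apply: vop_inj => x /=; exact: addNr. Qed.
HB.instance Definition _ := vop_zmod.

Program Definition vop_ring := @GRing.Zmodule_isNzRing.Build T
  vop_one vop_mul _ _ _ _ _ _.
Next Obligation. by move=> f g h; apply: vop_inj. Qed.
Next Obligation. by move=> f; apply: vop_inj. Qed.
Next Obligation. by move=> f; apply: vop_inj. Qed.
Next Obligation. by move=> f g h; apply: vop_inj. Qed.
Next Obligation. by move=> f g h; apply: vop_inj => x /=; exact: linearD. Qed.
Next Obligation.
apply/eqP => /(congr1 (fun f : T => tau f)) /= h1.
have := nfts_linear hT (-1) M1 M1.
rewrite scaleN1r addNr (nfts_unit hT) scaleN1r addNr -h1 (nfts_unit hT).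
by move/eqP; rewrite oner_eq0.
Qed.
HB.instance Definition _ := vop_ring.

Program Definition vop_lmod := @GRing.Zmodule_isLmodule.Build R T
  vop_scale _ _ _ _.
Next Obligation.
by intros; apply: vop_inj => x /=; rewrite !fctE scalerA rmorphM.
Qed.
Next Obligation. by move=> f; apply: vop_inj => x /=; exact: scale1r. Qed.
Next Obligation. by move=> r f g; apply: vop_inj => x /=; exact: scalerDr. Qed.
Next Obligation.
by move=> v r s; apply: vop_inj => x /=; rewrite rmorphD; exact: scalerDl.
Qed.
HB.instance Definition _ := vop_lmod.

Program Definition vop_lalg := @GRing.Lmodule_isLalgebra.Build R T _.
Next Obligation. by move=> r f g; apply: vop_inj. Qed.
HB.instance Definition _ := vop_lalg.

Program Definition vop_alg := @GRing.Lalgebra_isAlgebra.Build R T _.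
Next Obligation.
by move=> r f g; apply: vop_inj => x /=; rewrite !fctE linearZ.
Qed.
HB.instance Definition _ := vop_alg.

End VonNeumannAlgebra.

(** * Norm, adjoint, positivity and trace *)

Section VopTheory.
Variables (R : realType) (H : completeNormedModType R[i]).
Variables (ip : {dot H for Num.conj}).
Variables (M : set (H -> H)) (tau : (H -> H) -> R[i]).
Hypothesis hip : hilbert ip.
Variable hM : von_neumann_algebra ip M.
Variable hT : normal_faithful_tracial_state ip M tau.

Local Notation T := (vop hM hT).
Implicit Types f g : T.

Lemma vopD f g x : (f + g) x = f x + g x. Proof. by []. Qed.
Lemma vopN f x : (- f) x = - f x. Proof. by []. Qed.
Lemma vopB f g x : (f - g) x = f x - g x. Proof. by []. Qed.
Lemma vopM f g x : (f * g) x = f (g x). Proof. by []. Qed.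
Lemma vopZ (r : R) f x : (r *: f) x = r%:C *: f x. Proof. by []. Qed.
Lemma vop1 x : (1 : T) x = x. Proof. by []. Qed.

(** The norm of H takes its values in the complex numbers. *)
Definition rnorm (x : H) : R := complex.Re `|x|.

Lemma rnormE x : `|x| = (rnorm x)%:C.
Proof. by rewrite RRe_real // normr_real. Qed.

Lemma rnorm_ge0 x : 0 <= rnorm x.
Proof. by rewrite -ler0c -rnormE. Qed.

Lemma rnormD x y : rnorm (x + y) <= rnorm x + rnorm y.
Proof. by have := ler_normD x y; rewrite !rnormE -rmorphD lecR. Qed.

Lemma normcR (r : R) : `|r%:C| = `|r|%:C.
Proof. by rewrite normc_def /= expr0n /= addr0 sqrtr_sqr. Qed.

Lemma rnormZ (r : R) x : rnorm (r%:C *: x) = `|r| * rnorm x.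
Proof.
by have := normrZ r%:C x; rewrite !rnormE normcR -rmorphM => /complexI.
Qed.

Lemma ip_rnorm x : ip x x = (rnorm x ^+ 2)%:C.
Proof. by rewrite hip rnormE rmorphXn. Qed.

Definition bounded_by (f : T) (C : R) : Prop :=
  forall x, rnorm (f x) <= C * rnorm x.

Lemma bounded_by_exists f : exists2 C, 0 <= C & bounded_by f C.
Proof.
have cf : continuous (vfun f) by have [] := vna_bounded hM (vfunP f).
have /linear_bounded_continuous/linear_boundedP/pinfty_ex_gt0[C C0 fC] := cf.
have CE : C = (complex.Re C)%:C by rewrite RRe_real // gtr0_real.
exists (complex.Re C); first by rewrite -ler0c -CE ltW.
by move=> x; have := fC x; rewrite CE !rnormE -rmorphM lecR.
Qed.

Lemma bounded_by_opnorm f : bounded_by f (opnorm f).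
Proof.
have [C C0 fC] := bounded_by_exists f.
pose S := [set complex.Re `|f x| | x in [set x : H | `|x| <= 1]].
have ubS : has_ubound S.
  exists C => _ [x /= x1 <-]; apply: le_trans (fC x) _.
  by rewrite ler_piMr // -lecR -rnormE.
move=> x; have [->|x0] := eqVneq x 0.
  by rewrite linear0 /rnorm normr0 mulr0.
have nx0 : 0 < rnorm x by rewrite -ltcR -rnormE normr_gt0.
rewrite -ler_pdivrMr // mulrC -[(rnorm x)^-1]ger0_norm ?invr_ge0 ?rnorm_ge0 //.
rewrite -rnormZ -linearZ.
apply: ub_le_sup => //; exists ((rnorm x)^-1%:C *: x) => //=.
rewrite rnormE lecR rnormZ ger0_norm ?invr_ge0 ?rnorm_ge0 // mulVf ?gt_eqF //.
Qed.

Lemma bounded_by_le f (B C : R) : B <= C -> bounded_by f B -> bounded_by f C.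
Proof.
by move=> BC fB x; apply: le_trans (fB x) _; rewrite ler_wpM2r // rnorm_ge0.
Qed.

Lemma bounded_byD f g (B C : R) :
  bounded_by f B -> bounded_by g C -> bounded_by (f + g) (B + C).
Proof.
move=> fB gC x; rewrite vopD mulrDl; apply: le_trans (rnormD _ _) _.
exact: lerD.
Qed.

Lemma bounded_byM f g (B C : R) : 0 <= B ->
  bounded_by f B -> bounded_by g C -> bounded_by (f * g) (B * C).
Proof.
move=> B0 fB gC x; rewrite vopM -mulrA; apply: le_trans (fB _) _.
by rewrite ler_wpM2l.
Qed.

Lemma bounded_byZ (r : R) f (C : R) :
  0 <= r -> bounded_by f C -> bounded_by (r *: f) (r * C).
Proof.
move=> r0 fC x; rewrite vopZ rnormZ ger0_norm // -mulrA.
by rewrite ler_wpM2l.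
Qed.

Lemma bounded_by1 : bounded_by 1 1.
Proof. by move=> x; rewrite mul1r. Qed.

Lemma bounded_by0 : bounded_by 0 0.
Proof. by move=> x; rewrite mul0r /rnorm normr0. Qed.

Lemma bounded_byX f (B : R) n :
  0 <= B -> bounded_by f B -> bounded_by (f ^+ n) (B ^+ n).
Proof.
move=> B0 fB; elim: n => [|n IH]; first by rewrite !expr0; exact: bounded_by1.
by rewrite !exprS; exact: bounded_byM.
Qed.

(** Telescoping: [f^n - g^n] is a sum of n terms [f^i (f - g) g^(n-1-i)]. *)
Lemma bounded_by_subX f g (B d : R) n : 1 <= B -> 0 <= d ->
  bounded_by f B -> bounded_by g B ->
  bounded_by (f - g) d -> bounded_by (f ^+ n - g ^+ n) (n%:R * d * B ^+ n).
Proof.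
move=> B1 d0 fB gB fgd; have B0 : 0 <= B by apply: le_trans B1.
elim: n => [|n IH]; first by rewrite subrr !mul0r; exact: bounded_by0.
have -> : f ^+ n.+1 - g ^+ n.+1 = f * (f ^+ n - g ^+ n) + (f - g) * g ^+ n.
  by rewrite mulrBr mulrBl -!exprS addrA subrK.
have -> : n.+1%:R * d * B ^+ n.+1 =
    B * (n%:R * d * B ^+ n) + d * B ^+ n.+1 :> R.
  by rewrite exprS -natr1; ring.
apply: bounded_byD; first exact: bounded_byM.
apply: bounded_byM => //; apply: bounded_by_le (bounded_byX n B0 gB).
by rewrite exprS ler_peMl // exprn_ge0.
Qed.

Lemma vstar_subproof f : exists g : T, adjoint ip f g.
Proof.
by have [b Mb fb] := vna_adjoint hM (vfunP f); exists (Vop hM hT Mb).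
Qed.

Definition vstar f : T := projT1 (cid (vstar_subproof f)).

Lemma vstarP f x y : ip (f x) y = ip x (vstar f y).
Proof. by rewrite /vstar; case: cid => g /= ->. Qed.

Lemma vstar_unique f g : adjoint ip f g -> vstar f = g.
Proof.
move=> fg; apply: vop_inj => x; apply: (@ip_inj _ _ ip) => z.
exact: etrans (esym (vstarP f z x)) (fg z x).
Qed.

Lemma vstarPr f x y : ip x (f y) = ip (vstar f x) y.
Proof. by rewrite ip_conj vstarP -ip_conj. Qed.

Lemma selfadjoint_vstar f : selfadjoint ip f -> vstar f = f.
Proof. exact: vstar_unique. Qed.

Lemma vstar_linear : linear vstar.
Proof.
move=> r f g; apply: vstar_unique => x y.
rewrite !vopD !vopZ ipDl ipZl ipDr ipZr !vstarP.
by rewrite conjc_real.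
Qed.

HB.instance Definition _ := GRing.isLinear.Build R T T *:%R vstar vstar_linear.

Lemma vstarM f g : vstar (f * g) = vstar g * vstar f.
Proof. by apply: vstar_unique => x y; rewrite !vopM !vstarP. Qed.

Lemma vstarK : involutive vstar.
Proof. by move=> f; apply: vstar_unique => x y; rewrite vstarPr. Qed.

Lemma vstar1 : vstar 1 = 1.
Proof. exact: (star1 vstarK vstarM). Qed.

Lemma vstarX f n : vstar (f ^+ n) = vstar f ^+ n.
Proof. exact: (starX vstarK vstarM). Qed.

Lemma vstar_cscale (z : R[i]) f :
  vstar (vop_cscale z f) = vop_cscale (conjc z) (vstar f).
Proof.
by apply: vstar_unique => x y; rewrite /= !fctE ipZl ipZr conjcK vstarP.
Qed.

Definition pos f : Prop := positive_op ip f.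

Lemma posD f g : pos f -> pos g -> pos (f + g).
Proof. by move=> pf pg x; rewrite vopD ipDl addr_ge0. Qed.

Lemma posZ (r : R) f : 0 <= r -> pos f -> pos (r *: f).
Proof. by move=> r0 pf x; rewrite vopZ ipZl mulr_ge0 // ler0c. Qed.

Lemma pos_conj f g : pos f -> pos (vstar g * f * g).
Proof. by move=> pf x; rewrite !vopM -vstarPr. Qed.

Lemma pos_gram f : pos (vstar f * f).
Proof. by move=> x; rewrite vopM -vstarPr; exact: dnorm_ge0. Qed.

Lemma pos_sqr f : vstar f = f -> pos (f * f).
Proof. by move=> sf; rewrite -{1}sf; exact: pos_gram. Qed.

Lemma pos_sub_gram f C :
  0 <= C -> bounded_by f C -> pos ((C ^+ 2)%:A - vstar f * f).
Proof.
move=> C0 fC x; rewrite vopB ipBl vopZ ipZl vop1 vopM -vstarPr !ip_rnorm.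
rewrite -rmorphM -rmorphB ler0c subr_ge0 -exprMn.
by rewrite lerXn2r ?nnegrE ?mulr_ge0 ?rnorm_ge0.
Qed.

(** For [C > 0], [2 C (C - f) = (C - f)^2 + (C^2 - f^2)]. *)
Lemma pos_sub f C : 0 <= C -> bounded_by f C -> vstar f = f -> pos (C%:A - f).
Proof.
move=> C0 fC sf; have [CE|CN] := eqVneq C 0.
  move=> x; rewrite CE scale0r add0r vopN.
  have -> : f x = 0.
    apply/eqP; rewrite -normr_eq0 rnormE (_ : rnorm (f x) = 0) //.
    by apply: le_anti; have := fC x; rewrite CE mul0r => ->; exact: rnorm_ge0.
  by rewrite oppr0 -(scale0r (0 : H)) ipZl mul0r.
have Cp : 0 < C by rewrite lt_neqAle eq_sym CN.
have -> : C%:A - f = (2 * C)^-1 *: (vstar (C%:A - f) * (C%:A - f)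
                     + ((C ^+ 2)%:A - vstar f * f)).
  rewrite linearB linearZ /= vstar1 sf.
  have -> : (C%:A - f) * (C%:A - f) + ((C ^+ 2)%:A - f * f) =
            (C + C) *: (C%:A - f).
    rewrite mulrBl !mulrBr !mulr_algl !mulr_algr scalerA -expr2 opprB.
    rewrite -addrA [_ - _ + (_ - f * f)]addrC subrKA.
    by rewrite scalerDl scalerBr scalerA -expr2.
  by rewrite scalerA -mulr2n mulr_natl mulVf ?scale1r // mulrn_eq0.
apply: posZ; first by rewrite invr_ge0 mulr_ge0.
by apply: posD; [exact: pos_gram|exact: pos_sub_gram].
Qed.

(** The real part of tau is a trace on the real algebra of elements of M, and
    it is all that the real-linear arguments need. *)
Definition vtr f : R := complex.Re (tau f).

Lemma tau_clinear (z : R[i]) f g :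
  tau (vop_cscale z f + g : T) = z * tau f + tau g.
Proof. exact: (nfts_linear hT z (vfunP f) (vfunP g)). Qed.

Lemma vtr_linear : scalar vtr.
Proof.
move=> r f g; rewrite /vtr (tau_clinear r%:C).
by case: (tau f) (tau g) => a b [c d] /=; rewrite mul0r subr0.
Qed.

HB.instance Definition _ := GRing.isLinear.Build R T R *%R vtr vtr_linear.

Lemma vtr1 : vtr 1 = 1.
Proof. by rewrite /vtr /= (nfts_unit hT). Qed.

Lemma vtrC f g : vtr (f * g) = vtr (g * f).
Proof. by rewrite /vtr /= (nfts_tracial hT (vfunP f) (vfunP g)). Qed.

Lemma vtr_pos f : pos f -> 0 <= vtr f.
Proof.
move=> pf; have := nfts_positive hT (vfunP f) pf.
by rewrite /vtr lecE => /andP[].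
Qed.

Lemma tau_pos_real f : pos f -> complex.Im (tau f) = 0.
Proof.
move=> pf; have := nfts_positive hT (vfunP f) pf.
by rewrite lecE => /andP[/eqP -> ].
Qed.

Lemma tauD f g : tau (f + g : T) = tau f + tau g.
Proof.
have <- : vop_cscale 1 f + g = f + g.
  by apply: vop_inj => x; rewrite !vopD /= !fctE scale1r.
by rewrite tau_clinear mul1r.
Qed.

Lemma tau_cscale (z : R[i]) f : tau (vop_cscale z f) = z * tau f.
Proof.
have t0 : tau (0 : T) = 0.
  by apply: (addrI (tau (0 : T))); rewrite -tauD !addr0.
by rewrite -[vop_cscale z f]addr0 tau_clinear t0 addr0.
Qed.

Lemma tau_scale (r : R) f : tau (r *: f : T) = r%:C * tau f.
Proof. exact: tau_cscale. Qed.

(** A self-adjoint f is half the difference of the positive elements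
    [(f + 1)^2] and [f^2 + 1]. *)
Lemma tau_selfadjoint_real f : vstar f = f -> complex.Im (tau f) = 0.
Proof.
move=> sf.
pose a := (f + 1) * (f + 1); pose b := f * f + 1 * 1.
have pa : pos a by apply: pos_sqr; rewrite linearD /= sf vstar1.
have pb : pos b by apply: posD; apply: pos_sqr => //; exact: vstar1.
have ab : a = b + (f + f).
  by rewrite /a /b mulrDl mulrDr !mulr1 mul1r (addrC f 1) addrACA.
have := tauD b (f + f); rewrite -ab tauD.
have /= := tau_pos_real pa; have /= := tau_pos_real pb.
case: (tau a) (tau b) (tau f) => a1 a2 [b1 b2] [c1 c2] /= -> -> [_].
by rewrite add0r -mulr2n => /esym/eqP; rewrite mulrn_eq0 => /eqP.
Qed.

(** [i (f - star f)] is self-adjoint, so its trace is real. *)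
Lemma vtr_star f : vtr (vstar f) = vtr f.
Proof.
pose k := vop_cscale 'i (f - vstar f).
have sk : vstar k = k.
  rewrite vstar_cscale linearB /= vstarK; apply: vop_inj => x.
  change (conjc 'i *: (vstar f - f) x = 'i *: (f - vstar f) x).
  rewrite !vopB -opprB scalerN -scaleNr; congr (_ *: _).
  by apply/eqP; rewrite eq_complex /= oppr0 opprK !eqxx.
have := tau_selfadjoint_real sk; rewrite /k tau_cscale tauD.
have -> : tau (- vstar f : T) = - tau (vstar f).
  by rewrite -scaleN1r tau_scale rmorphN1 mulN1r.
rewrite /vtr; case: (tau f) (tau (vstar f)) => a b [c d] /=.
rewrite !mul0r add0r mul1r.
by move/eqP; rewrite subr_eq0 => /eqP.
Qed.

Lemma vtr_gram_ge0 f : 0 <= vtr (vstar f * f).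
Proof. exact/vtr_pos/pos_gram. Qed.

Lemma norm_vtr_le f C : 0 <= C -> bounded_by f C -> `|vtr f| <= C.
Proof.
move=> C0 fC.
have := tr_cauchy_schwarz vstarK vstarM vtrC vtr_star vtr_gram_ge0 f 1.
rewrite /= vstar1 !mulr1 vtr1 mulr1 => h.
have := vtr_pos (pos_sub_gram C0 fC).
rewrite linearB /= scalarZ /= vtr1 mulr1 subr_ge0 => h'.
have : vtr f ^+ 2 <= C ^+ 2 by exact: le_trans h'.
by rewrite -[leLHS]real_normK ?num_real // ler_pXn2r ?nnegrE.
Qed.

Lemma vtr_golden_thompson f g k : vstar f = f -> vstar g = g ->
  vtr ((f * g) ^+ (2 ^ k)) <= vtr (f ^+ (2 ^ k) * g ^+ (2 ^ k)).
Proof.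
exact: (tr_golden_thompson vstarK vstarM vtrC vtr_star vtr_gram_ge0).
Qed.

(** A quantitative Lie-Trotter formula and the Golden-Thompson inequality in
    one.  The error is of order [1 / 2^k], with a constant that depends only on
    the bounds B and C of the norms of f and g. *)
Lemma vtr_powD_golden_thompson f g (B C : R) k :
  0 <= B -> 0 <= C -> bounded_by f B -> bounded_by g C ->
  vstar f = f -> vstar g = g ->
  vtr ((1 + (2 ^ k)%:R^-1 *: (f + g)) ^+ (2 ^ k)) <=
  vtr ((1 + (2 ^ k)%:R^-1 *: f) ^+ (2 ^ k) *
       (1 + (2 ^ k)%:R^-1 *: g) ^+ (2 ^ k))
  + B * C * expR (B + C) / (2 ^ k)%:R.
Proof.
move=> B0 C0 fB gC sf sg; set m : R := (2 ^ k)%:R.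
have m0 : 0 < m by rewrite ltr0n expn_gt0.
set e := m^-1; have e0 : 0 <= e by rewrite invr_ge0 ltW.
have s1 := vstar1.
(* X and Y have norm at most b, with b^m independent of m, and their
   difference is of order 1 / m^2. *)
set X := (1 + e *: f) * (1 + e *: g); set Y := 1 + _.
have XY : X - Y = (e * e) *: (f * g).
  have -> : X = Y + (e * e) *: (f * g).
    rewrite /X /Y mulrDl mul1r mulrDr mulr1 -scalerAl -(scalerAr e f g).
    by rewrite scalerA scalerDr !addrA; congr (_ + _); exact: addrAC.
  by rewrite addrAC subrr add0r.
have XYb : bounded_by (X - Y) (e * e * (B * C)).
  by rewrite XY; apply: bounded_byZ; [rewrite mulr_ge0|apply: bounded_byM].
set b := expR (e * (B + C)).
have b1 : 1 <= b by rewrite -expR0 ler_expR mulr_ge0 // addr_ge0.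
have Xb : bounded_by X b.
  apply: (@bounded_by_le _ ((1 + e * B) * (1 + e * C))).
    rewrite /b (mulrDr e) expRD.
    by rewrite ler_pM ?expR_ge1Dx // addr_ge0 // mulr_ge0.
  apply: bounded_byM; first by rewrite addr_ge0 // mulr_ge0.
    by apply: bounded_byD; [exact: bounded_by1|exact: bounded_byZ].
  by apply: bounded_byD; [exact: bounded_by1|exact: bounded_byZ].
have Yb : bounded_by Y b.
  apply: (@bounded_by_le _ (1 + e * (B + C))); first exact: expR_ge1Dx.
  apply: bounded_byD; first exact: bounded_by1.
  by apply: bounded_byZ => //; exact: bounded_byD.
have bm : b ^+ (2 ^ k) = expR (B + C).
  by rewrite /b -expRM_natr mulrAC mulVf ?mul1r // gt_eqF.
have d0 : 0 <= e * e * (B * C) by rewrite !mulr_ge0.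
have := norm_vtr_le _ (bounded_by_subX (2 ^ k) b1 d0 Xb Yb XYb).
rewrite bm linearB /= -/m => h.
have {h} h : `|vtr (X ^+ (2 ^ k)) - vtr (Y ^+ (2 ^ k))| <=
    B * C * expR (B + C) * e.
  apply: le_trans (h _) _; first by rewrite !mulr_ge0 ?expR_ge0 // ltW.
  rewrite le_eqVlt; apply/orP; left; apply/eqP.
  by rewrite /e; field; rewrite gt_eqF.
have gt : vtr (X ^+ (2 ^ k)) <=
          vtr ((1 + e *: f) ^+ (2 ^ k) * (1 + e *: g) ^+ (2 ^ k)).
  by apply: vtr_golden_thompson; rewrite linearD linearZ /= s1 (sf, sg).
move: h; rewrite ler_norml => /andP[h _]; lra.
Qed.

(** The Taylor remainder of order two.  It is written [f * q * f], with q
    self-adjoint, so that a bound on q yields an operator inequality; q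
    satisfies the recursion [q' = q (1 + e f) + n e^2] from [q = 0], and the
    constant c is the value of the same recursion at the number B. *)
Lemma quadratic_powD f (B e : R) n :
  0 < B -> 0 <= e -> bounded_by f B -> vstar f = f ->
  let c := ((1 + e * B) ^+ n - 1 - n%:R * (e * B)) / B ^+ 2 in
  exists2 q : T, [/\ bounded_by q c, vstar q = q & q * f = f * q] &
  (1 + e *: f) ^+ n = 1 + (n%:R * e) *: f + f * q * f /\ 0 <= c.
Proof.
move=> B0 e0 fB sf; elim: n => [|n [q [qc sq qf] [IH c0]]] c.
  have -> : c = 0 by rewrite /c expr0 mul0r subrr subr0 mul0r.
  exists 0.
    by split; [exact: bounded_by0|rewrite linear0|rewrite mulr0 mul0r].
  by split=> //; rewrite !mul0r scale0r mulr0 mul0r !addr0.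
move: qc c0; set c' := (X in bounded_by q X) => qc c0.
have cE : c = c' * (1 + e * B) + n%:R * e ^+ 2.
  by rewrite /c /c' exprS -natr1; field; rewrite gt_eqF.
have s1 := vstar1.
have q1 : q * (1 + e *: f) = (1 + e *: f) * q.
  by rewrite mulrDr mulrDl mulr1 mul1r -scalerAl -[in LHS]scalerAr qf.
have f1 : (1 + e *: f) * f = f * (1 + e *: f).
  by rewrite mulrDr mulrDl mulr1 mul1r -scalerAl -[in RHS]scalerAr.
exists (q * (1 + e *: f) + (n%:R * e ^+ 2)%:A).
  split.
  - rewrite cE -[X in bounded_by _ (_ + X)]mulr1; apply: bounded_byD.
      apply: bounded_byM => //.
      by apply: bounded_byD; [exact: bounded_by1|apply: bounded_byZ].
    by apply: bounded_byZ; [rewrite mulr_ge0 ?sqr_ge0|exact: bounded_by1].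
  - rewrite linearD linearZ /= s1 vstarM linearD linearZ /= s1 sf sq.
    by rewrite -q1.
  - by rewrite mulrDl mulr_algl [RHS]mulrDr mulr_algr -mulrA f1 !mulrA qf.
split; last first.
  rewrite cE; apply: addr_ge0; last by rewrite mulr_ge0 ?sqr_ge0.
  by apply: mulr_ge0 => //; rewrite addr_ge0 // mulr_ge0 // ltW.
have -> : f * (q * (1 + e *: f) + (n%:R * e ^+ 2)%:A) * f =
          f * q * f * (1 + e *: f) + (n%:R * e ^+ 2) *: (f * f).
  by rewrite mulrDr mulr_algr mulrDl -scalerAl !mulrA -!(mulrA _ f) -f1 !mulrA.
rewrite exprSr IH 2!mulrDl mul1r.
have -> : (n%:R * e) *: f * (1 + e *: f) =
          (n%:R * e) *: f + (n%:R * e ^+ 2) *: (f * f).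
  by rewrite mulrDr mulr1 -scalerAl -scalerAr scalerA -mulrA -expr2.
rewrite -natr1 (mulrDl n%:R) mul1r scalerDl addrACA -!addrA.
by congr (_ + (_ + (_ + _))); exact: addrC.
Qed.

Lemma pos_quadratic_powD f (B e : R) n :
  0 < B -> 0 <= e -> bounded_by f B -> vstar f = f ->
  let c := ((1 + e * B) ^+ n - 1 - n%:R * (e * B)) / B ^+ 2 in
  0 <= c /\ pos (1 + (n%:R * e) *: f + c *: (f * f) - (1 + e *: f) ^+ n).
Proof.
move=> B0 e0 fB sf c.
have [q [qc sq qf] [-> c0]] := quadratic_powD n B0 e0 fB sf.
split=> //; rewrite addrAC opprD addrA subrr add0r addrC.
have -> : c *: (f * f) - f * q * f = vstar f * (c%:A - q) * f.
  by rewrite sf mulrBr mulr_algr mulrBl -scalerAl.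
by apply/pos_conj/pos_sub.
Qed.

(** Pinching: the trace of f is the sum of those of its corners at [p] and at
    [1 - p], and the second corner is positive. *)
Lemma vtr_compress p f : vstar p = p -> p * p = p -> pos f ->
  vtr (p * f * p) <= vtr f.
Proof.
move=> sp pp pf.
have sq : vstar (1 - p) = 1 - p.
  by rewrite linearB /= sp vstar1.
have qq : (1 - p) * (1 - p) = 1 - p.
  by rewrite mulrBr mulr1 mulrBl mul1r pp subrr subr0.
have := vtr_pos (pos_conj (1 - p) pf).
rewrite sq vtrC mulrA qq mulrBl mul1r linearB /= subr_ge0.
by rewrite vtrC mulrA pp.
Qed.

(** The inequality [p f p >= c p] passes to squares since
    [f^2 - c^2 = (f - c)^2 + 2 c (f - c)]; iterating gives the powers [2^j]. *)
Lemma vtr_markov p f (c : R) k : vstar p = p -> p * p = p -> vstar f = f ->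
  0 <= c -> pos (p * (f - c%:A) * p) ->
  c ^+ (2 ^ k.+1) * vtr p <= vtr (f ^+ (2 ^ k.+1)).
Proof.
move=> sp pp sf c0.
have step (d : R) g : vstar g = g -> 0 <= d -> pos (p * (g - d%:A) * p) ->
    pos (p * (g * g - (d * d)%:A) * p).
  move=> sg d0 h.
  have -> : g * g - (d * d)%:A = vstar (g - d%:A) * (g - d%:A)
      + (2 * d) *: (g - d%:A).
    have -> : vstar (g - d%:A) = g - d%:A.
      by rewrite linearB linearZ /= vstar1 sg.
    rewrite -[(2 * d) *: _]mulr_algr -mulrDr.
    have -> : g - d%:A + (2 * d)%:A = g + d%:A.
      by rewrite -addrA -scaleNr -scalerDl; congr (_ + _ *: _); ring.
    rewrite mulrBl !mulrDr !mulr_algl !mulr_algr scalerA opprD addrA.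
    by rewrite addrK.
  rewrite mulrDr mulrDl -scalerAr -scalerAl; apply: posD; last first.
    by apply: posZ => //; rewrite mulr_ge0.
  by rewrite -{1}sp; apply: pos_conj; exact: pos_gram.
move=> h.
have H2 j : pos (p * (f ^+ (2 ^ j) - (c ^+ (2 ^ j))%:A) * p).
  elim: j => [|j IH]; first by rewrite !expr1.
  have := step (c ^+ (2 ^ j)) (f ^+ (2 ^ j)).
  rewrite vstarX sf -!expr2 -!exprM -!expnSr.
  by rewrite exprn_ge0 //; apply.
have := vtr_pos (H2 k.+1).
rewrite mulrBr mulrBl mulr_algr -scalerAl pp linearB /= scalarZ /= subr_ge0.
move=> /le_trans; apply; apply: vtr_compress => //.
rewrite expnSr exprM expr2; apply: pos_sqr.
by rewrite vstarX sf.
Qed.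

End VopTheory.

(** * Spectral tails *)

Lemma fine_measure_le_Rintegral (R : realType)
    (mu : {finite_measure set R -> \bar R}) (t : R) :
  mu.-integrable setT (EFin : R -> \bar R) -> mu [set x | x < t] = 0%E ->
  t * fine (mu setT) <= \int[mu]_(y in setT) y.
Proof.
move=> imu mu0.
have mN : measurable [set x : R | x < t].
  by rewrite -set_itvNyo; exact: measurable_itv.
have mC : measurable (setT `\` [set x : R | x < t]) by exact: measurableD.
have iC : mu.-integrable (setT `\` [set x : R | x < t]) (EFin : R -> \bar R).
  by apply: integrableS imu.
have muC : mu setT = mu (setT `\` [set x : R | x < t]).
  rewrite -[in LHS](setUv [set x : R | x < t]) measureU //; last first.
  - exact: setICr.
  - exact: measurableC.
  by rewrite [X in (X + _)%E]mu0 add0e setTD.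
rewrite /Rintegral (negligible_integral mN) // muC -[leLHS]Rintegral_cst //.
apply: le_Rintegral => //; last by move=> x /= [_ /negP]; rewrite -leNgt.
exact: finite_measure_integrable_cst.
Qed.

Section Spectral.
Variables (R : realType) (H : completeNormedModType R[i]).
Variables (ip : {dot H for Num.conj}).
Variables (M : set (H -> H)) (tau : (H -> H) -> R[i]).
Hypothesis hip : hilbert ip.
Variable hM : von_neumann_algebra ip M.
Variable hT : normal_faithful_tracial_state ip M tau.
Local Notation T := (vop hM hT).

Lemma spectral_measure_set0 (S : H -> H) (P : set R -> H -> H) x :
  spectral_measure ip M S P -> P set0 x = 0.
Proof.
move=> hP; have [mu [muP _ _]] := sm_integral hP x.
have [_ [_ sa pp]] := sm_proj hP measurable0.
apply/eqP; rewrite -(dnorm_eq0 ip) -sa.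
have /= -> := congr1 (fun F : H -> H => F x) pp.
by rewrite muP // measure0.
Qed.

(** At a vector [y = p x], the spectral measure of f is carried by [[t, oo[],
    because [P ]-oo, t[ y = 0] by multiplicativity of P. *)
Lemma spectral_tail (f p : T) (P : set R -> H -> H) (t : R) :
  spectral_measure ip M f P -> vfun p = P [set x | t <= x] ->
  [/\ vstar p = p, p * p = p & pos (p * (f - t%:A) * p)].
Proof.
move=> hP pE.
have mt : measurable [set x : R | t <= x].
  by rewrite -set_itvcy; exact: measurable_itv.
have mN : measurable [set x : R | x < t].
  by rewrite -set_itvNyo; exact: measurable_itv.
have [_ [_ sa pp]] := sm_proj hP mt.
have sp : vstar p = p by apply: selfadjoint_vstar; rewrite pE.
split=> //.
  by apply: vop_ext; rewrite /= pE; exact: pp.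
move=> x; rewrite !vopM -{1}sp ip_conj vstarPr vstarK -ip_conj.
set y := p x.
have [mu [muP imu fy]] := sm_integral hP y.
rewrite vopB ipBl vopZ ipZl vop1 fy.
have -> : ip y y = (fine (mu setT))%:C by rewrite -muP // (sm_setT hP).
rewrite -rmorphM -rmorphB ler0c subr_ge0.
apply: fine_measure_le_Rintegral => //.
have : P [set x | x < t] y = 0.
  rewrite /y pE.
  have /= <- := congr1 (fun F : H -> H => F x) (sm_setI hP mN mt).
  rewrite (_ : _ `&` _ = set0); first exact: spectral_measure_set0 hP.
  by rewrite -subset0 => z [] /=; rewrite ltNge => /negP.
move=> Py0.
have := muP _ mN; rewrite Py0 -(scale0r (0 : H)) ipZl mul0r.
move=> /esym/(@complexI R) h.
by rewrite -(fineK (fin_num_measure mu _ mN)) h.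
Qed.

End Spectral.

(** * Successive independence and the tail bound *)

Section Bennett.
Variables (R : realType) (H : completeNormedModType R[i]).
Variables (ip : {dot H for Num.conj}).
Variables (M : set (H -> H)) (tau : (H -> H) -> R[i]).
Hypothesis hip : hilbert ip.
Variable hM : von_neumann_algebra ip M.
Variable hT : normal_faithful_tracial_state ip M tau.
Local Notation T := (vop hM hT).
Local Notation tr := (@vtr R H ip M tau hM hT).
Variables (N : set (H -> H)) (E : (H -> H) -> (H -> H)).
Hypothesis hN : von_neumann_algebra ip N.
Hypothesis NM : N `<=` M.
Hypothesis hE : conditional_expectation ip M N tau E.

Definition cexp (f : T) : T := Vop hM hT (NM (ce_range hE (vfunP f))).

Lemma cexp_linear : linear cexp.
Proof.
move=> r f g; exact/vop_ext/(ce_linear hE r%:C (vfunP f) (vfunP g)).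
Qed.

HB.instance Definition _ := GRing.isLinear.Build R T T *:%R cexp cexp_linear.

Lemma cexp1 : cexp 1 = 1.
Proof. by apply: vop_inj => x /=; rewrite (ce_unit hE). Qed.

Lemma vtr_cexp f : tr (cexp f) = tr f.
Proof. by rewrite /vtr /= (ce_trace hE (vfunP f)). Qed.

Lemma pos_cexp f : pos f -> pos (cexp f).
Proof. exact: ce_positive hE _ (vfunP f). Qed.

Lemma cexp_cexpM f g : cexp (cexp f * g) = cexp f * cexp g.
Proof.
have [N1 _ _] := vna_subalgebra hN.
exact/vop_ext/(ce_bimodule hE (ce_range hE (vfunP f)) N1 (vfunP g)).
Qed.

(** Independence and the bimodule property replace u by [cexp u] under the
    trace, and then [tr (v * (h * h)) = tr (h * v * h)] is monotone in v.  The
    second factor is a square so that no square root has to be taken. *)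
Lemma vtr_independent_le (u h : T) (K : R) : vstar h = h ->
  cexp (u * (h * h)) = cexp u * cexp (h * h) -> pos (K%:A - cexp u) ->
  tr (u * (h * h)) <= K * tr (h * h).
Proof.
move=> sh uh Ku.
rewrite -[tr (u * _)]vtr_cexp uh -cexp_cexpM vtr_cexp -subr_ge0.
have := vtr_pos (pos_conj h Ku).
by rewrite sh vtrC mulrA vtrC mulrBl mulr_algl linearB /= scalarZ.
Qed.

Lemma pos_cexp_powD f (s B e : R) m : 0 < B -> 0 <= e -> bounded_by f B ->
  vstar f = f -> cexp f = 0 -> pos ((s ^+ 2)%:A - cexp (f * f)) ->
  let c := ((1 + e * B) ^+ m - 1 - m%:R * (e * B)) / B ^+ 2 in
  pos ((1 + c * s ^+ 2)%:A - cexp ((1 + e *: f) ^+ m)).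
Proof.
move=> B0 e0 fB sf f0 fs c.
have [c0 h] := pos_quadratic_powD hip m B0 e0 fB sf.
have cE : cexp (1 + (m%:R * e) *: f + c *: (f * f) - (1 + e *: f) ^+ m) =
    1 + c *: cexp (f * f) - cexp ((1 + e *: f) ^+ m).
  by rewrite linearB 2!linearD !linearZ /= f0 scaler0 addr0 cexp1.
have -> : (1 + c * s ^+ 2)%:A - cexp ((1 + e *: f) ^+ m) =
  c *: ((s ^+ 2)%:A - cexp (f * f)) +
  cexp (1 + (m%:R * e) *: f + c *: (f * f) - (1 + e *: f) ^+ m).
  rewrite cE scalerBr scalerA scalerDl scale1r [1 + c *: _]addrC addrA.
  by rewrite [_ - _ + (_ + 1)]addrA subrK [_ + 1]addrC.
by apply: posD; [exact: posZ|exact: pos_cexp].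
Qed.

Lemma subalgebra_powD (D : set (H -> H)) (f : T) (e : R) m : subalgebra D ->
  D f -> D ((1 + e *: f) ^+ m : T).
Proof.
move=> [D1 DP DM] Df; elim: m => [|m IH]; first by [].
rewrite exprS; apply: (DM _ _ _ IH).
by rewrite addrC; exact: (DP e%:C).
Qed.

Lemma subalgebra_generated (S : set (H -> H)) :
  subalgebra (generated_algebra S).
Proof.
split.
- by move=> D [[]].
- move=> z a b ha hb D hD; have [[_ DP _] _] := hD.
  by apply: DP; [exact: ha|exact: hb].
- move=> a b ha hb D hD; have [[_ _ DM] _] := hD.
  by apply: DM; [exact: ha|exact: hb].
Qed.

Variables (n : nat) (A : 'I_n -> set (H -> H)) (a : 'I_n -> T).
Variables (sigma : 'I_n -> R) (B : R).
Hypothesis hA : forall j, von_neumann_algebra ip (A j).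
Hypothesis hind : successively_independent E A.
Hypothesis Aa : forall j, A j (a j).
Hypothesis sa : forall j, vstar (a j) = a j.
Hypothesis B0 : 0 < B.
Hypothesis aB : forall j, bounded_by (a j) B.
Hypothesis a0 : forall j, cexp (a j) = 0.
Hypothesis a2 : forall j, pos ((sigma j ^+ 2)%:A - cexp (a j * a j)).

Definition psum (k : nat) : T := \sum_(i < n | (i < k)%N) a i.

Lemma psum0 : psum 0 = 0.
Proof. by rewrite /psum big_pred0. Qed.

Lemma psumS (k : 'I_n) : psum k.+1 = psum k + a k.
Proof.
rewrite /psum (bigD1 k) //= addrC; congr (_ + _); apply: eq_bigl => i.
by rewrite ltnS andbC -ltn_neqAle.
Qed.

Lemma vstar_psum k : vstar (psum k) = psum k.
Proof. by rewrite linear_sum; apply: eq_bigr => i _; exact: sa. Qed.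

Lemma bounded_by_psum k : (k <= n)%N -> bounded_by (psum k) (k%:R * B).
Proof.
elim: k => [|k IH] kn; first by rewrite psum0 mul0r; exact: bounded_by0.
rewrite (psumS (Ordinal kn)) -natr1 mulrDl mul1r.
by apply: bounded_byD => //; exact: IH (ltnW kn).
Qed.

Lemma generated_psum (k : nat) :
  generated_algebra (\bigcup_(i in [set i : 'I_n | (i < k)%N]) A i) (psum k).
Proof.
have [G1 GP _] := subalgebra_generated
  (\bigcup_(i in [set i : 'I_n | (i < k)%N]) A i).
rewrite /psum; elim/big_ind : _ => [|f g Gf Gg|i ik].
- have := GP (-1) _ _ G1 G1; rewrite scaleN1r addNr; exact.
- by have := GP 1 _ _ Gf Gg; rewrite scale1r.
- by apply: sub_gen_smallest; exists i.
Qed.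

(** The case [k = 0] is apart: there is no independence assumption on the first
    algebra, but the partial sum vanishes. *)
Lemma cexp_independent (k : 'I_n) (e : R) m m' :
  cexp ((1 + e *: a k) ^+ m * (1 + e *: psum k) ^+ m') =
  cexp ((1 + e *: a k) ^+ m) * cexp ((1 + e *: psum k) ^+ m').
Proof.
have [k0|k0] := posnP k.
  by rewrite k0 psum0 scaler0 addr0 expr1n mulr1 cexp1 mulr1.
have Ak := subalgebra_powD e m (vna_subalgebra (hA k)) (Aa k).
have Gk := subalgebra_powD e m' (@subalgebra_generated _) (@generated_psum k).
exact/vop_ext/(hind k0 Ak Gk).
Qed.

Lemma powD_rate_le (l : R) (m : nat) : 0 <= l -> (0 < m)%N ->
  ((1 + m%:R^-1 * l * B) ^+ m - 1 - m%:R * (m%:R^-1 * l * B)) / B ^+ 2 <=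
  bennett_rate B l.
Proof.
case: m => // m l0 _; rewrite ler_pM2r ?invr_gt0 ?exprn_gt0 //.
rewrite -!mulrA mulVKf ?pnatr_eq0 // !lerD2r.
rewrite mulrC expR_ge_powD //.
by rewrite (@le_trans _ _ 0) // ?mulr_ge0 ?oppr_le0 // ltW.
Qed.

(** The constant C is independent of j, so the errors of the n steps still
    vanish in the limit. *)
Lemma mgf_step (k : 'I_n) (l : R) : 0 <= l -> exists C, forall j,
  tr ((1 + (2 ^ j.+1)%:R^-1 *: (l *: psum k.+1)) ^+ (2 ^ j.+1)) <=
  expR (bennett_rate B l * sigma k ^+ 2) *
    tr ((1 + (2 ^ j.+1)%:R^-1 *: (l *: psum k)) ^+ (2 ^ j.+1))
  + C / (2 ^ j.+1)%:R.
Proof.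
move=> l0.
exists (l * (k%:R * B) * (l * B) * expR (l * (k%:R * B) + l * B)) => j.
set m := (2 ^ j.+1)%N.
have m0 : 0 < m%:R :> R by rewrite ltr0n expn_gt0.
have e0 : 0 <= m%:R^-1 * l by rewrite mulr_ge0 // invr_ge0 ltW.
have kB : 0 <= k%:R * B by rewrite mulr_ge0 // ltW.
rewrite psumS scalerDr.
apply: le_trans (vtr_powD_golden_thompson hip _ _ _ _ _ _ _) _.
- by apply: (@mulr_ge0 _ l (k%:R * B)).
- by apply: (@mulr_ge0 _ l B) => //; exact: ltW.
- by apply: bounded_byZ => //; apply: bounded_by_psum; exact: ltnW.
- by apply: bounded_byZ.
- by rewrite linearZ /= vstar_psum.
- by rewrite linearZ /= sa.
rewrite lerD2r vtrC !scalerA.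
set h := (1 + (m%:R^-1 * l) *: psum k) ^+ (2 ^ j).
have sh : vstar h = h.
  by rewrite vstarX linearD linearZ /= vstar_psum vstar1.
have hh : (1 + (m%:R^-1 * l) *: psum k) ^+ m = h * h.
  by rewrite /h -exprD addnn -mul2n -expnS.
have := cexp_independent k (m%:R^-1 * l) m m; rewrite hh => ind.
have := pos_cexp_powD m B0 e0 (aB k) (sa k) (a0 k) (a2 k) => /= pK.
apply: le_trans (vtr_independent_le sh ind pK) _.
apply: ler_wpM2r; first by apply/vtr_pos/pos_sqr.
apply: le_trans (expR_ge1Dx _); rewrite lerD2l ler_wpM2r ?sqr_ge0 //.
by apply: powD_rate_le; rewrite ?expn_gt0.
Qed.

Lemma mgf_bound (k : nat) (l : R) : 0 <= l -> (k <= n)%N -> exists C, forall j,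
  tr ((1 + (2 ^ j.+1)%:R^-1 *: (l *: psum k)) ^+ (2 ^ j.+1)) <=
  expR (bennett_rate B l * \sum_(i < n | (i < k)%N) sigma i ^+ 2)
  + C / (2 ^ j.+1)%:R.
Proof.
move=> l0; elim: k => [|k IH] kn.
  exists 0 => j; rewrite psum0 !scaler0 addr0 expr1n vtr1 big_pred0 //.
  by rewrite mulr0 expR0 mul0r addr0.
have [C hC] := IH (ltnW kn).
have [D hD] := mgf_step (Ordinal kn) l0.
set K := expR (bennett_rate B l * sigma (Ordinal kn) ^+ 2) in hD.
exists (K * C + D) => j.
apply: le_trans (hD j) _.
have -> : \sum_(i < n | (i < k.+1)%N) sigma i ^+ 2 =
   sigma (Ordinal kn) ^+ 2 + \sum_(i < n | (i < k)%N) sigma i ^+ 2.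
  rewrite (bigD1 (Ordinal kn)) //=; congr (_ + _); apply: eq_bigl => i.
  by rewrite ltnS andbC -(inj_eq val_inj) /= -ltn_neqAle.
rewrite [bennett_rate B l * _]mulrDr expRD -/K [(_ + D) / _]mulrDl addrA lerD2r.
rewrite -[K * C / _]mulrA -[K * _ + K * _]mulrDr.
by rewrite ler_pM2l ?expR_gt0.
Qed.

(** Both sides of Markov's inequality for [(1 + (l / m) sum)^m] converge as
    [m = 2^(j+1)] grows: [(1 + l t / m)^m] to [exp (l t)] with relative error
    at most [(l t)^2 / m], and the error C / m of the moment bound to 0. *)
Lemma bennett_tail (P : set R -> H -> H) (t l : R) : 0 <= t -> 0 <= l ->
  spectral_measure ip M (\sum_j vfun (a j)) P ->
  Prob tau P t <= expR (bennett_exponent (\sum_j sigma j ^+ 2) B t l).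
Proof.
move=> t0 l0 hP.
have mt : measurable [set x : R | t <= x].
  by rewrite -set_itvcy; exact: measurable_itv.
pose p : T := Vop hM hT (sm_proj hP mt).1.
have -> : Prob tau P t = tr p by [].
have sumE : vfun (psum n) = \sum_j vfun (a j).
  rewrite /psum (big_morph (@vfun R H ip M tau hM hT) (id1 := 0)
    (op1 := +%R)) //.
  by apply: eq_bigl => i; rewrite ltn_ord.
have hS : spectral_measure ip M (psum n) P by rewrite sumE.
have [sp pp ptail] := spectral_tail hS (erefl _ : vfun p = _).
have p0 : 0 <= tr p.
  by apply: vtr_pos; rewrite -pp; exact: pos_sqr.
have [C hC] := mgf_bound l0 (leqnn n).
rewrite /bennett_exponent expRD expRN ler_pdivlMr ?expR_gt0 //.
apply: (@le_of_le_div_expn2 _ _ _ (C + tr p * expR (l * t) * (l * t) ^+ 2)).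
move=> j.
set m := (2 ^ j.+1)%N.
have m0 : 0 < m%:R :> R by rewrite ltr0n expn_gt0.
have e0 : 0 <= m%:R^-1 * l by rewrite mulr_ge0 // invr_ge0 ltW.
have c0 : 0 <= 1 + m%:R^-1 * l * t by rewrite addr_ge0 // mulr_ge0.
have sX : vstar (1 + (m%:R^-1 * l) *: psum n) = 1 + (m%:R^-1 * l) *: psum n.
  by rewrite linearD linearZ /= vstar_psum vstar1.
have := vtr_markov j sp pp sX c0; rewrite -/m => markov.
have {markov} : (1 + m%:R^-1 * l * t) ^+ m * tr p <=
    tr ((1 + (m%:R^-1 * l) *: psum n) ^+ m).
  apply: markov.
  have -> : 1 + (m%:R^-1 * l) *: psum n - (1 + m%:R^-1 * l * t)%:A =
            (m%:R^-1 * l) *: (psum n - t%:A).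
    by rewrite scalerDl scale1r opprD addrACA subrr add0r scalerBr scalerA.
  by rewrite -scalerAr -scalerAl; exact: posZ.
have := hC j; rewrite -/m scalerA => h1 h2.
have := le_trans h2 h1.
have -> : \sum_(i < n | (i < n)%N) sigma i ^+ 2 = \sum_j sigma j ^+ 2.
  by apply: eq_bigl => i; rewrite ltn_ord.
rewrite [bennett_rate B l * _]mulrC => h3.
have h4 : expR (l * t) * (1 - (l * t) ^+ 2 / m%:R) <=
          (1 + m%:R^-1 * l * t) ^+ m.
  have := @expR_le_powD _ (l * t) m.-1 (mulr_ge0 l0 t0).
  by rewrite prednK ?expn_gt0 // -[_ * l * t]mulrA [_ * (l * t)]mulrC.
have := le_trans (ler_wpM2r p0 h4) h3.
move: (expR ((\sum_j _) * _)) (expR (l * t)) => K L.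
move: (m%:R^-1) => w h; rewrite -subr_ge0 in h; rewrite -subr_ge0.
by apply: le_trans h _; rewrite le_eqVlt; apply/orP; left; apply/eqP; ring.
Qed.

End Bennett.

Unset Implicit Arguments.

(** * The two tail inequalities *)

Theorem corollary0p2 (R : realType) (H : completeNormedModType R[i])
    (ip : {dot H for Num.conj})
    (M N : set (H -> H)) (tau : (H -> H) -> R[i]) (E : (H -> H) -> (H -> H))
    (n : nat) (A : 'I_n -> set (H -> H)) (a : 'I_n -> H -> H)
    (sigma m : 'I_n -> R) (P : set R -> H -> H) :
  hilbert ip ->
  von_neumann_algebra ip M ->
  normal_faithful_tracial_state ip M tau ->
  von_neumann_algebra ip N -> N `<=` M ->
  conditional_expectation ip M N tau E ->
  (forall j, [/\ von_neumann_algebra ip (A j), N `<=` A j & A j `<=` M]) ->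
  successively_independent E A ->
  (forall j, A j (a j) /\ selfadjoint ip (a j)) ->
  (forall j, 0 <= sigma j /\ 0 <= m j) ->
  0 < \sum_j sigma j ^+ 2 ->
  0 < \big[Num.max/0]_j m j ->
  (forall j, E (a j) = 0) ->
  (forall j, ople ip (E (a j \o a j)) ((sigma j ^+ 2)%:C *: idfun)) ->
  (forall j, opnorm (a j) <= m j) ->
  spectral_measure ip M (\sum_j a j) P ->
  forall t : R, 0 <= t ->
    Prob tau P t <=
      expR (- (t ^+ 2 / (2 * \sum_j sigma j ^+ 2
                         + (2 * t / 3) * \big[Num.max/0]_j m j))) /\
    Prob tau P t <=
      expR (- (t / (2 * \big[Num.max/0]_j m j)
               * arcsinh (t * \big[Num.max/0]_j m j
                          / (2 * \sum_j sigma j ^+ 2)))).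
Proof.
move=> hip hM hT hN NM hE hA hind ha hsm V0 B0 a0 a2 aB hP t t0.
set B := \big[Num.max/0]_j m j in B0 *; set V := \sum_j sigma j ^+ 2 in V0 *.
have AM j : M (a j) by have [_ _] := hA j; apply; exact: (ha j).1.
pose f j : vop hM hT := Vop hM hT (AM j).
have tail l : 0 <= l -> Prob tau P t <= expR (bennett_exponent V B t l).
  move=> l0; apply: (@bennett_tail R H ip M tau hip hM hT N E hN NM hE n A f
    sigma B _ hind _ _ B0 _ _ _ P t l t0 l0 hP).
  - by move=> j; have [] := hA j.
  - by move=> j; exact: (ha j).1.
  - by move=> j; apply: selfadjoint_vstar; exact: (ha j).2.
  - move=> j; apply: bounded_by_le (bounded_by_opnorm (f j)).
    by apply: le_trans (aB j) _; exact: le_bigmax.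
  - by move=> j; apply: vop_ext; exact: a0.
  - by move=> j; exact: a2.
have [l l0 lE] := bernstein_exponent V0 B0 t0.
have [l' l'0 l'E] := prokhorov_exponent V0 B0 t0.
by split; [apply: le_trans (tail l l0) _|apply: le_trans (tail l' l'0) _];
  rewrite ler_expR.
Qed.
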